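(* Let $D_m=(X_1,\ldots,X_m)$ be i.i.d. observations from a distribution $P$, let $\theta_0=\phi(P)\in\mathbb R^d$ be a functional of $P$, $\widehat\theta_m=\phi(P_m)$ with $P_m$ the empirical distribution of $X_1,\ldots,X_m$, $S:\mathbb R^d\to\mathbb R$ a function, $\tau_m$ a normalizing rate, and $S_m(\theta)=S(\tau_m(\widehat\theta_m-\theta))$. For $b=1,\ldots,B$ let $(X_1^{*b},\ldots,X_m^{*b})$ be bootstrap samples of size $m$ drawn from $P_m$ (independently across $b$ given $D_m$), $\widehat\theta_m^{*b}=\phi(P_m^{*b})$ with $P_m^{*b}$ the empirical distribution of the $b$-th bootstrap sample, and $W_b=S(\tau_m(\widehat\theta_m^{*b}-\widehat\theta_m))$, with order statistics $W_{(1)}\le\cdots\le W_{(B)}$. For $\alpha\in(0,1)$ define the modified bootstrap confidence set $$\mathrm{CI}=\Big\{\theta:\ S_m(\theta)\in\big[W_{(\lfloor(B+1)(\alpha/2)\rfloor)},\,W_{(\lceil(B+1)(1-\alpha)\rceil+\lfloor(B+1)(\alpha/2)\rfloor)}\big)\Big\}.$$ With $F_0(D_m)=\mathbb P(W_b\le S_m(\theta_0)\mid D_m)$ (which does not depend on $b$), $$\Big|\mathbb P(\theta_0\in\mathrm{CI})-\frac{\lceil(B+1)(1-\alpha)\rceil}{B+1}\Big|\le\widetilde d_{\mathrm{KS}}(F_0(D_m),U(0,1)),$$ and consequently $$-\widetilde d_{\mathrm{KS}}(F_0(D_m),U(0,1))\le\mathbb P(\theta_0\in\mathrm{CI})-(1-\alpha)\le\frac1{B+1}+\widetilde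 d_{\mathrm{KS}}(F_0(D_m),U(0,1)).$$
   Context: All maps are assumed measurable. For real random variables, $\widetilde d_{\mathrm{KS}}(Y_1,Y_2)=\sup_{s,t\in\mathbb R}|\mathbb P(Y_1\in(s,t])-\mathbb P(Y_2\in(s,t])|$; $U(0,1)$ denotes a standard uniform random variable. Conventions: $W_{(0)}=-\infty$ and $W_{(B+1)}=+\infty$ (the corresponding endpoint constraint is vacuous). The probability $\mathbb P(\theta_0\in\mathrm{CI})$ is over both the data and the bootstrap resampling. *)

(* Defs.v *)
From HB Require Import structures.
From mathcomp Require Import all_boot all_order all_algebra.
From mathcomp Require Import all_classical all_reals all_analysis.

Set Implicit Arguments.
Unset Strict Implicit.
Unset Printing Implicit Defensive.

Import Order.TTheory GRing.Theory Num.Theory.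

Local Open Scope classical_set_scope.
Local Open Scope ring_scope.

(* The product sigma-algebra on row vectors, as for n.-tuple T; on 'rV[R]_n
   with R real this is the Borel sigma-algebra of R^n. *)
Section measurable_rV.
Context {d : measure_display} {T : measurableType d} {n : nat}.

Let coors : 'I_n -> 'rV[T]_n -> T := fun j v => v ord0 j.

Let rV_set0 : g_sigma_preimage coors set0.
Proof. exact: sigma_algebra0. Qed.

Let rV_setC A : g_sigma_preimage coors A -> g_sigma_preimage coors (~` A).
Proof. exact: sigma_algebraC. Qed.

Let rV_bigcup (F : _^nat) : (forall i, g_sigma_preimage coors (F i)) ->
  g_sigma_preimage coors (\bigcup_i (F i)).
Proof. exact: sigma_algebra_bigcup. Qed.

HB.instance Definition _ := @isMeasurable.Build (measure_tuple_display d)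
  'rV[T]_n (g_sigma_preimage coors) rV_set0 rV_setC rV_bigcup.

End measurable_rV.

Section empirical.
Local Open Scope ereal_scope.
Context {R : realType} {d : measure_display} {T : measurableType d} {m : nat}.

(* The sample size has to be positive for this to be a probability, whence the
   argument hm, on which the value does not depend. *)
Definition empirical (hm : (0 < m)%N) (x : m.-tuple T) : set T -> \bar R :=
  fun A => (m%:R^-1)%R%:E * \sum_(i < m) \d_(tnth x i) A.

Variables (hm : (0 < m)%N) (x : m.-tuple T).

Let invm_ge0 : (0 <= m%:R^-1 :> R)%R.
Proof. by rewrite invr_ge0. Qed.

Let empiricalE : empirical hm x =
  mscale (NngNum invm_ge0) (msum (fun k => \d_(nth point x k)) m).
Proof.
apply/funext => A; rewrite /empirical /mscale /msum /=; congr (_ * _).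
by apply: eq_bigr => i _; rewrite (tnth_nth point).
Qed.

Let empirical0 : empirical hm x set0 = 0.
Proof. by rewrite empiricalE measure0. Qed.

Let empirical_ge0 A : 0 <= empirical hm x A.
Proof. by rewrite empiricalE. Qed.

Let empirical_sigma_additive : semi_sigma_additive (empirical hm x).
Proof. by rewrite empiricalE; exact: measure_semi_sigma_additive. Qed.

HB.instance Definition _ := isMeasure.Build _ _ _ (empirical hm x)
  empirical0 empirical_ge0 empirical_sigma_additive.

Let empirical_setT : empirical hm x setT = 1.
Proof.
rewrite /empirical (eq_bigr (fun=> 1%:E)) => [|i _]; last by rewrite diracT.
rewrite sumEFin sumr_const card_ord -EFinM mulVf//.
by rewrite pnatr_eq0 -lt0n.
Qed.

HB.instance Definition _ :=
  Measure_isProbability.Build _ _ _ (empirical hm x) empirical_setT.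

End empirical.

Section sampling.
Local Open Scope ereal_scope.
Context {R : realType} {dO : measure_display} {Omega : measurableType dO}.
Context (Prob : probability Omega R).
Context {d : measure_display} {T : measurableType d} {m : nat}.

(* Subfamilies need not be considered: put A i = setT outside of them. *)
Definition independent_RVs (X : 'I_m -> Omega -> T) : Prop :=
  forall A : 'I_m -> set T, (forall i, measurable (A i)) ->
  Prob (\bigcap_i (X i @^-1` A i)) = \prod_(i < m) Prob (X i @^-1` A i).

Definition iid (P : probability T R) (X : 'I_m -> Omega -> T) : Prop :=
  independent_RVs X /\
  forall i (A : set T), measurable A -> Prob (X i @^-1` A) = P A.

(* The conditional law of the B * m resampled points given D = x is the
   (B * m)-fold product of the empirical distribution of x. *)
Definition bootstrap_samples (hm : (0 < m)%N) (B : nat)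
    (D : Omega -> m.-tuple T) (Xstar : 'I_B -> 'I_m -> Omega -> T) : Prop :=
  forall (A : set (m.-tuple T)) (E : 'I_B -> 'I_m -> set T),
  measurable A -> (forall b i, measurable (E b i)) ->
  Prob (D @^-1` A `&` \bigcap_b \bigcap_i (Xstar b i @^-1` E b i)) =
  \int[Prob]_(w in D @^-1` A)
    \prod_(b < B) \prod_(i < m) empirical hm (D w) (E b i).

(* f(D) is a version of the conditional probability of the event E given D. *)
Definition is_cond_prob d' (V : measurableType d') (D : Omega -> V)
    (E : set Omega) (f : V -> R) : Prop :=
  [/\ measurable_fun setT f,
      Prob.-integrable setT (fun w => (f (D w))%:E) &
      forall A : set V, measurable A ->
        Prob (D @^-1` A `&` E) = \int[Prob]_(w in D @^-1` A) (f (D w))%:E].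

End sampling.

Definition KS_dist (R : realType)
    d1 (T1 : measurableType d1) (P1 : probability T1 R) (Y1 : T1 -> R)
    d2 (T2 : measurableType d2) (P2 : probability T2 R) (Y2 : T2 -> R) : R :=
  sup [set r | exists s t : R,
    r = `| fine (P1 (Y1 @^-1` `]s, t]%classic))
         - fine (P2 (Y2 @^-1` `]s, t]%classic)) | ].

(* W_(k), with W_(0) = -oo and W_(B+1) = +oo. *)
Definition order_stat (R : realType) (B : nat) (W : 'I_B -> R) (k : nat) :
    \bar R :=
  nth +oo%E (-oo%E :: map EFin (sort <=%R (codom W))) k.

(* Main.v *)
Require Import Defs.
From HB Require Import structures.
From mathcomp Require Import all_boot all_order all_algebra.
From mathcomp Require Import all_classical all_reals all_analysis.
From mathcomp Require Import measurable_realfun.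
From mathcomp Require Import ring lra.

(* Given the data, the bootstrap sample is one of the m ^ m resamplings of the
   data, chosen uniformly. Hence the number of b with W_b <= S_m(theta_0) is
   conditionally binomial with parameters B and p = F_0(D_m), and theta_0 lies in
   the confidence set iff this number is in [l, k + l[. With H_j(p) the
   probability that a binomial (B, p) variable is at least j, the coverage is
   therefore E[h(F_0(D_m))], where h = H_l - H_(k + l), whereas
   E[h(U)] = k / (B + 1) for U uniform, each binomial mass having integral
   1 / (B + 1) over [0, 1]. As H_l and H_(k + l) are nondecreasing in p, the set
   {H_(k + l) <= c < H_l} is an interval ]s, t] for every level c, and averaging
   over c gives |E[h(Y)] - E[h(U)]| <= KS_dist Y U. Averaging over the finitely
   many levels c = i / N, up to an error 1 / N, avoids Fubini's theorem. *)

Set Implicit Arguments.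
Unset Strict Implicit.
Unset Printing Implicit Defensive.

Import Order.TTheory GRing.Theory Num.Theory.
Import numFieldNormedType.Exports.

Local Open Scope classical_set_scope.
Local Open Scope ring_scope.

(** * Binomial tail probabilities as functions of the success probability *)

Section binomial_tail.
Context {R : realType}.
Implicit Types (p q : R) (n i j : nat).

Definition binomial_mass n i p : R := 'C(n, i)%:R * (p ^+ i * (1 - p) ^+ (n - i)).

Definition binomial_tail n j p : R := \sum_(j <= i < n.+1) binomial_mass n i p.

Lemma binomial_mass_ge0 n i p : 0 <= p <= 1 -> 0 <= binomial_mass n i p.
Proof. by move=> /andP[p0 p1]; rewrite !mulr_ge0// exprn_ge0// subr_ge0. Qed.

Lemma binomial_mass_gt n p i : (n < i)%N -> binomial_mass n i p = 0.
Proof. by move=> ni; rewrite /binomial_mass bin_small// mul0r. Qed.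

Lemma binomial_tail0 n p : binomial_tail n 0 p = 1.
Proof.
rewrite /binomial_tail big_mkord -[RHS](expr1n _ n).
rewrite -[in RHS](subrK p 1) exprDn.
by apply: eq_bigr => i _; rewrite /binomial_mass mulr_natl mulrC.
Qed.

Lemma binomial_tail_gt n j p : (n < j)%N -> binomial_tail n j p = 0.
Proof. by move=> nj; rewrite /binomial_tail big_geq. Qed.

Lemma binomial_tailB n j k p : (j <= k <= n.+1)%N ->
  binomial_tail n j p - binomial_tail n k p = \sum_(j <= i < k) binomial_mass n i p.
Proof.
by move=> /andP[jk kn]; rewrite /binomial_tail (big_cat_nat jk kn)/= addrK.
Qed.

Lemma le_binomial_tail n j k p : 0 <= p <= 1 -> (j <= k)%N ->
  binomial_tail n k p <= binomial_tail n j p.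
Proof.
move=> p01 jk; rewrite -subr_ge0.
have mass_ge0 a b : 0 <= \sum_(a <= i < b) binomial_mass n i p.
  by apply: sumr_ge0 => i _; exact: binomial_mass_ge0.
have [kn|nk] := leqP k n.+1; first by rewrite binomial_tailB ?jk.
by rewrite (binomial_tail_gt _ (ltnW nk)) subr0; exact: mass_ge0.
Qed.

Lemma binomial_tail_ge0 n j p : 0 <= p <= 1 -> 0 <= binomial_tail n j p.
Proof. by move=> p01; apply: sumr_ge0 => i _; exact: binomial_mass_ge0. Qed.

Lemma binomial_tail_le1 n j p : 0 <= p <= 1 -> binomial_tail n j p <= 1.
Proof. by move=> p01; rewrite -(binomial_tail0 n p); exact: le_binomial_tail. Qed.

(** Conditioning on one trial: either it succeeds and j further successes are needed, or it fails
    and j + 1 are. Term by term this is Pascal's rule [binS]. *)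
Lemma binomial_tailS n j p : binomial_tail n.+1 j.+1 p =
  p * binomial_tail n j p + (1 - p) * binomial_tail n j.+1 p.
Proof.
(* The added term i = n + 1 is zero; with it all ranges agree after the index shift. *)
have -> : binomial_tail n j.+1 p = \sum_(j.+1 <= i < n.+2) binomial_mass n i p.
  have [jn|nj] := leqP j n; last first.
    by rewrite /binomial_tail !big_geq// ltnW.
  by rewrite big_nat_recr//= binomial_mass_gt// addr0.
rewrite /binomial_tail !big_add1/= !mulr_sumr -big_split/=.
apply: eq_big_nat => i /andP[_ iln].
rewrite /binomial_mass binS natrD subSS.
(* For i = n the exponent [n - i.+1] is truncated, but its coefficient ['C(n, n.+1)] vanishes. *)
have [->|ni] := eqVneq i n; first by rewrite bin_small// subnn exprS; ring.
have -> : (n - i = (n - i.+1).+1)%N by rewrite subnSK// ltn_neqAle ni -ltnS.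
by rewrite !exprS; ring.
Qed.

(** Induction on n through [binomial_tailS], a convex combination of two tails. Passing from p to q
    raises both tails and shifts weight to the larger one. *)
Lemma binomial_tail_homo n j : {in [pred p : R | 0 <= p <= 1] &,
  {homo binomial_tail n j : p q / p <= q}}.
Proof.
elim: n j => [|n IHn] [|j] p q p01 q01 pq; rewrite ?binomial_tail0//.
  by rewrite !binomial_tail_gt.
rewrite !binomial_tailS.
have := IHn j _ _ p01 q01 pq; have := IHn j.+1 _ _ p01 q01 pq.
have := le_binomial_tail n p01 (leqnSn j).
move: p01 q01; rewrite !inE => /andP[p0 p1] /andP[q0 q1].
move: (binomial_tail _ _ _) (binomial_tail _ _ _) (binomial_tail _ _ _) => a b c.
by move: (binomial_tail _ _ _) => d; nra.
Qed.

Lemma continuous_binomial_tail n j : continuous (binomial_tail n j).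
Proof.
have -> : binomial_tail n j = \sum_(j <= i < n.+1) binomial_mass n i.
  by apply/funext => p; rewrite fct_sumE.
elim/big_ind: _ => [|f g cf cg|i _] p; [exact: cvg_cst| |].
  by apply: cvgD; [exact: cf|exact: cg].
apply: cvgM; first exact: cvg_cst.
by apply: cvgM; [exact: exprn_continuous|exact: continuous_onemXn].
Qed.

Lemma measurable_binomial_tail n j : measurable_fun setT (binomial_tail n j).
Proof.
by apply: continuous_measurable_fun; exact: continuous_binomial_tail.
Qed.

Lemma integrable_binomial_mass n i :
  (@lebesgue_measure R).-integrable `[0%R, 1%R] (EFin \o binomial_mass n i).
Proof.
rewrite (_ : _ \o _ = fun p : R => ('C(n, i)%:R%:E * (XMonemX i (n - i) p)%:E)%E).
  by apply: integrableZl => //; exact: integrable_XMonemX.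
by apply/funext => p /=; rewrite -EFinM.
Qed.

(** The integral of p ^ i (1 - p) ^ (n - i) is the beta value B(i + 1, n - i + 1) = i! (n - i)! / (n
    + 1)!. *)
Lemma integral_binomial_mass n i : (i <= n)%N ->
  (\int[lebesgue_measure]_(p in `[0%R, 1%R]) (binomial_mass n i p)%:E =
   (n.+1%:R^-1)%:E :> \bar R)%E.
Proof.
move=> ilen.
under eq_integral do rewrite EFinM.
rewrite integralZl//; last exact: integrable_XMonemX.
have /= := EFin_beta_fun i.+1 (n - i).+1 (R := R).
rewrite beta_fun_fact subnKC// => h.
rewrite integral_mkcond.
under eq_integral do rewrite restrict_EFin.
rewrite -h -EFinM; congr EFin.
have fact_neq0 k : k`!%:R != 0 :> R by rewrite pnatr_eq0 -lt0n fact_gt0.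
have bin_neq0 : 'C(n, i)%:R != 0 :> R by rewrite pnatr_eq0 -lt0n bin_gt0.
have n1_neq0 : n.+1%:R != 0 :> R by rewrite pnatr_eq0.
rewrite factS -(bin_fact ilen) !natrM.
by field; rewrite ?fact_neq0 ?bin_neq0 ?nat1r ?natr1 ?n1_neq0.
Qed.

End binomial_tail.

(** * Differences of monotone functions and the Kolmogorov-Smirnov distance *)

Section KS.
Context {R : realType}.

(** Monotonicity makes the sublevel set an initial segment of [0, 1], and continuity makes it
    contain its supremum, which serves as [s]. If it is empty, any negative [s] will do. *)
Lemma level_set_itv (g : R -> R) (c : R) :
  {in [pred p : R | 0 <= p <= 1] &, {homo g : p q / p <= q}} -> continuous g ->
  exists s, forall p, 0 <= p <= 1 -> (g p <= c) = (p <= s).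
Proof.
move=> g_homo g_cont; pose A := [set p : R | 0 <= p <= 1 /\ g p <= c].
have [A0|A0] := pselect (A !=set0); last first.
  exists (-1) => p p01; transitivity false; last first.
    by apply/esym/negbTE; rewrite -ltNge; case/andP : p01; lra.
  by apply/negbTE/negP => gpc; apply: A0; exists p.
have supA : has_sup A by split => //; exists 1 => p [/andP[]].
exists (sup A) => p p01; apply/idP/idP => [gpc|p_supA].
  by apply: sup_upper_bound.
rewrite leNgt; apply/negP => cgp.
have A_le_p a : A a -> a <= p.
  move=> [a01 gac]; rewrite leNgt; apply/negP => /ltW pa.
  by have := g_homo p a p01 a01 pa; lra.
have : \forall x \near p, c < g x by exact: (cvgr_gt (g p)) (g_cont p) _ cgp.
move=> /nbhs_ballP[e /= e0 pe].
have [a Aa aesup] := sup_adherent e0 supA.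
have /pe/= : ball p e a.
  by rewrite /ball/= ger0_norm ?subr_ge0 ?A_le_p//; lra.
by case: Aa => _; lra.
Qed.

(** The sum counts the naturals below y, so it is the ceiling of y; the bound y <= N ensures that
    none is missed. *)
Lemma sum_ltr_nat (N : nat) (y : R) : 0 <= y <= N%:R ->
  y <= \sum_(i < N) (i%:R < y)%R%:R <= y + 1.
Proof.
elim: N => [|N IHN] /andP[y0 yN]; first by rewrite mulr0n in yN; rewrite big_ord0; lra.
rewrite big_ord_recr/=; have [Ny|yN'] := ltrP N%:R y; last first.
  by rewrite addr0 IHN// y0.
rewrite (eq_bigr (fun=> 1)) => [|i _]; last first.
  by rewrite (le_lt_trans _ Ny)// ler_nat ltnW.
by rewrite sumr_const card_ord /= mulr1n; rewrite -natr1 in yN; lra.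
Qed.

Lemma probability_setI_full d (T : measurableType d) (mu : probability T R)
    (A B : set T) : measurable A -> measurable B -> mu B = 1%E ->
  mu (A `&` B) = mu A.
Proof.
move=> mA mB muB.
rewrite [RHS](measureDI mu mA mB) [X in (X + _)%E](_ : _ = 0%E) ?add0e//.
apply/eqP; rewrite eq_le measure_ge0 andbT.
rewrite (_ : 0%E = mu (~` B)); last by rewrite probability_setC// muB subee.
apply: le_measure; rewrite ?inE; last exact: subDsetr.
  exact: measurableD.
exact: measurableC.
Qed.

Lemma fine_probability_01 d (T : measurableType d) (mu : probability T R)
  (A : set T) : measurable A -> 0 <= fine (mu A) <= 1.
Proof.
move=> mA; rewrite fine_ge0//= -lee_fin fineK ?fin_num_measure//.
exact: probability_le1.
Qed.

Lemma KS_dist_ub d1 (T1 : measurableType d1) (P1 : probability T1 R) (Y1 : T1 -> R)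
    d2 (T2 : measurableType d2) (P2 : probability T2 R) (Y2 : T2 -> R) (s t : R) :
  measurable_fun setT Y1 -> measurable_fun setT Y2 ->
  `| fine (P1 (Y1 @^-1` `]s, t]%classic)) - fine (P2 (Y2 @^-1` `]s, t]%classic)) |
    <= KS_dist P1 Y1 P2 Y2.
Proof.
move=> mY1 mY2; apply: ub_le_sup; last by exists s, t.
exists 1 => _ [a [b ->]].
have m1 : measurable (Y1 @^-1` `]a, b]).
  by rewrite -[X in measurable X]setTI; exact: mY1.
have m2 : measurable (Y2 @^-1` `]a, b]).
  by rewrite -[X in measurable X]setTI; exact: mY2.
have := fine_probability_01 P1 m1; have := fine_probability_01 P2 m2.
by rewrite ler_norml; lra.
Qed.

Lemma bounded01_integrable (mu : probability R R) (f : R -> R) (M : R) :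
  measurable_fun setT f -> (forall x, 0 <= x <= 1 -> `|f x| <= M) ->
  mu.-integrable `[0, 1] (EFin \o f).
Proof.
move=> mf fM; apply: measurable_bounded_integrable => //.
- by rewrite (le_lt_trans (probability_le1 _ _))// ltry.
- exact: measurable_funTS.
- exists M; split; first exact: num_real.
  by move=> y My x /=; rewrite in_itv/= => /fM fxM; lra.
Qed.

(** A discrete layer-cake formula: up to 1 / N, g1 p - g2 p is the proportion of levels i / N with
    g2 p <= i / N < g1 p, and by the hypotheses on s and t this condition says that p lies in ]s i,
    t i]. Integrating over p turns the indicators into interval probabilities. *)
Lemma Rintegral_monotone_diff_approx (mu : probability R R) (g1 g2 : R -> R) (N : nat)
    (s t : 'I_N -> R) : mu `[0, 1]%classic = 1%E -> (0 < N)%N ->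
  measurable_fun setT g1 -> measurable_fun setT g2 ->
  (forall p : R, 0 <= p <= 1 -> [&& 0 <= g2 p, g2 p <= g1 p & g1 p <= 1]) ->
  (forall (i : 'I_N) (p : R), 0 <= p <= 1 -> (g1 p <= i%:R / N%:R) = (p <= s i)) ->
  (forall (i : 'I_N) (p : R), 0 <= p <= 1 -> (g2 p <= i%:R / N%:R) = (p <= t i)) ->
  `| \int[mu]_(p in `[0, 1]) (g1 p - g2 p)
     - N%:R^-1 * \sum_(i < N) fine (mu `]s i, t i]%classic) | <= N%:R^-1.
Proof.
move=> mu1 N0 mg1 mg2 g01 sE tE.
have N0' : 0 < N%:R :> R by rewrite ltr0n.
pose w p : R := N%:R^-1 * \sum_(i < N) \1_(`]s i, t i]%classic) p.
have m_indic i : measurable_fun setT (\1_(`]s i, t i]%classic) : R -> R) by [].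
have mw : measurable_fun setT w.
  by apply: measurable_funM => //; exact: measurable_sum.
have w_approx p : 0 <= p <= 1 -> `|(g1 p - g2 p) - w p| <= N%:R^-1.
  move=> p01; have /and3P[g2_ge0 g21 g1_le1] := g01 _ p01.
  have -> : w p = N%:R^-1 * (\sum_(i < N) (i%:R < N%:R * g1 p)%R%:R -
                            \sum_(i < N) (i%:R < N%:R * g2 p)%R%:R).
    rewrite /w -sumrB; congr (_ * _); apply: eq_bigr => i _.
    rewrite indicE mem_setE in_itv/= ltNge -sE// -tE//.
    rewrite !(mulrC N%:R) -!ltr_pdivrMr// -ltNge.
    case: (leP (g2 p)) => [_|ig2]; first by rewrite andbT subr0.
    by rewrite andbF (lt_le_trans ig2 g21) subrr.
  set S1 := \sum_(i < N) (i%:R < N%:R * g1 p)%R%:R.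
  set S2 := \sum_(i < N) (i%:R < N%:R * g2 p)%R%:R.
  (* Both rounding errors have the same sign and size at most 1, so their difference is at most 1,
     giving the bound 1 / N rather than 2 / N. *)
  have /andP[S1l S1u] : N%:R * g1 p <= S1 <= N%:R * g1 p + 1.
    by apply: sum_ltr_nat; apply/andP; split; nra.
  have /andP[S2l S2u] : N%:R * g2 p <= S2 <= N%:R * g2 p + 1.
    by apply: sum_ltr_nat; apply/andP; split; nra.
  have -> : g1 p - g2 p - N%:R^-1 * (S1 - S2) =
      N%:R^-1 * ((N%:R * g1 p - S1) - (N%:R * g2 p - S2)).
    by field; rewrite gt_eqF.
  rewrite normrM ger0_norm ?invr_ge0 ?ler0n// ler_piMr ?invr_ge0 ?ler0n//.
  by rewrite ler_norml; lra.
have int_h : mu.-integrable `[0, 1] (EFin \o (fun p => g1 p - g2 p)).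
  apply: (@bounded01_integrable _ _ 1); first exact: measurable_funB.
  by move=> p /g01/and3P[? ? ?]; rewrite ler_norml; lra.
have int_w : mu.-integrable `[0, 1] (EFin \o w).
  apply: (@bounded01_integrable _ _ (1 + N%:R^-1)) => // p p01.
  have := w_approx _ p01; have /and3P[? ? ?] := g01 _ p01.
  by rewrite !ler_norml; lra.
have <- : \int[mu]_(p in `[0, 1]) w p =
    N%:R^-1 * \sum_(i < N) fine (mu `]s i, t i]%classic).
  rewrite RintegralZl//; last first.
    apply: (@bounded01_integrable _ _ N%:R); first exact: measurable_sum.
    move=> p p01; rewrite ger0_norm; last by apply: sumr_ge0.
    apply: (@le_trans _ _ (\sum_(i < N) 1)); last by rewrite sumr_const card_ord.
    by apply: ler_sum => i _; rewrite indicE; case: (_ \in _).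
  congr (_ * _); rewrite /Rintegral.
  under eq_integral do rewrite -sumEFin.
  rewrite integral_sum//; last first.
    move=> i; apply: (@bounded01_integrable _ _ 1) => // p _.
    by rewrite indicE; case: (_ \in _); rewrite ?normr1 ?normr0.
  rewrite -sum_fine; last first.
    by move=> i _; rewrite integral_indic// fin_num_measure//; exact: measurableI.
  apply: eq_bigr => i _; rewrite integral_indic//; congr fine.
  exact: probability_setI_full.
rewrite -RintegralB//; apply: le_trans (le_normr_Rintegral _ _) _ => //.
  apply: (@bounded01_integrable _ _ N%:R^-1); last exact: w_approx.
  by do 2?apply: measurable_funB.
apply: le_trans (_ : \int[mu]_(p in `[0, 1]) N%:R^-1 <= _); last first.
  by rewrite Rintegral_cst// [X in fine X]mu1 mulr1.
apply: le_Rintegral => //.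
- apply: (@bounded01_integrable _ _ N%:R^-1).
    by apply: measurableT_comp => //; do 2?apply: measurable_funB.
  by move=> p /w_approx; rewrite normr_id.
- exact: (@bounded01_integrable _ (cst N%:R^-1) `|N%:R^-1|).
Qed.

Lemma KS_dist_monotone_diff d1 (T1 : measurableType d1) (P1 : probability T1 R)
    (Y1 : {RV P1 >-> R}) d2 (T2 : measurableType d2) (P2 : probability T2 R)
    (Y2 : {RV P2 >-> R}) (g1 g2 : R -> R) :
  distribution P1 Y1 `[0, 1]%classic = 1%E ->
  distribution P2 Y2 `[0, 1]%classic = 1%E ->
  continuous g1 -> continuous g2 ->
  {in [pred p : R | 0 <= p <= 1] &, {homo g1 : p q / p <= q}} ->
  {in [pred p : R | 0 <= p <= 1] &, {homo g2 : p q / p <= q}} ->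
  (forall p : R, 0 <= p <= 1 -> [&& 0 <= g2 p, g2 p <= g1 p & g1 p <= 1]) ->
  `| \int[distribution P1 Y1]_(p in `[0, 1]) (g1 p - g2 p)
     - \int[distribution P2 Y2]_(p in `[0, 1]) (g1 p - g2 p) |
    <= KS_dist P1 Y1 P2 Y2.
Proof.
move=> Y1_01 Y2_01 cg1 cg2 g1_homo g2_homo g01.
apply/ler_addgt0Pr => e e0.
(* The discretization costs 1 / N for each of the two laws, hence N > 2 / e. *)
pose N := (Num.truncn (2 / e)).+1.
have N0 : 0 < N%:R :> R by rewrite ltr0n.
have Ne : 2 * N%:R^-1 < e.
  by rewrite ltr_pdivrMr// mulrC -ltr_pdivrMr// truncnS_gt.
have [s sE] := choice (fun i : 'I_N => level_set_itv (i%:R / N%:R) g1_homo cg1).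
have [t tE] := choice (fun i : 'I_N => level_set_itv (i%:R / N%:R) g2_homo cg2).
have mg1 := continuous_measurable_fun cg1.
have mg2 := continuous_measurable_fun cg2.
have := Rintegral_monotone_diff_approx Y1_01 (ltn0Sn _) mg1 mg2 g01 sE tE.
have := Rintegral_monotone_diff_approx Y2_01 (ltn0Sn _) mg1 mg2 g01 sE tE.
pose mu1 := distribution P1 Y1; pose mu2 := distribution P2 Y2.
pose S1 := \sum_(i < N) fine (mu1 `]s i, t i]%classic).
pose S2 := \sum_(i < N) fine (mu2 `]s i, t i]%classic).
rewrite -/S1 -/S2.
(* The endpoints s i and t i depend only on g1 and g2, so both laws are compared on the same
   intervals, and an average of N differences is bounded by their common bound. *)
have : `|N%:R^-1 * S1 - N%:R^-1 * S2| <= KS_dist P1 Y1 P2 Y2.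
  rewrite -mulrBr -sumrB normrM ger0_norm ?invr_ge0 ?ler0n//.
  rewrite ler_pdivrMl//; apply: le_trans (ler_norm_sum _ _ _) _.
  apply: le_trans (ler_sum _ _) _ => [i _|]; first exact: KS_dist_ub.
  by rewrite sumr_const card_ord mulr_natl.
move: (N%:R^-1 * S1) (N%:R^-1 * S2) Ne => a1 a2; rewrite -/mu1 -/mu2.
move: (N%:R^-1) (\int[mu1]_(p in _) _) (\int[mu2]_(p in _) _) (KS_dist _ _ _ _).
by move=> x y1 y2 K; rewrite !ler_norml; lra.
Qed.

End KS.

(** Bundles a function with its measurability proof, so that [distribution] applies to it. *)
Definition RV_of d d' (T : measurableType d) (T' : measurableType d')
    (R : realType) (P : probability T R) (f : T -> T')
    (mf : measurable_fun setT f) : {RV P >-> T'} :=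
  HB.pack f (isMeasurableFun.Build _ _ _ _ f mf).

(** * Finite mixtures of measures *)

Section mixture.
Local Open Scope ereal_scope.
Context {d} {V : measurableType d} {R : realType} {I : finType}.

(** Finite measures that agree on a generating class closed under intersection and containing the
    whole space are equal. The mixture is first written as a measure, [nu_sum]. *)
Lemma eq_mixture (c : {nonneg R}) (G : set (set V))
    (mu : {measure set V -> \bar R}) (nu : I -> {measure set V -> \bar R}) :
  measurable = <<s G>> -> setI_closed G -> G setT -> mu setT < +oo ->
  (forall A, G A -> mu A = c%:num%:E * \sum_i nu i A) ->
  forall A, measurable A -> mu A = c%:num%:E * \sum_i nu i A.
Proof.
move=> mG GI GT muT muG A mA.
pose m0 : {measure set V -> \bar R} := mzero.
pose nus k := nth m0 [seq nu i | i <- enum I] k.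
pose nu_sum := mscale c (msum nus #|I|).
have nuE B : nu_sum B = c%:num%:E * \sum_i nu i B.
  rewrite /nu_sum /mscale /msum; congr (_ * _).
  rewrite -[RHS]big_enum.
  rewrite -(big_map nu xpredT (fun m : {measure set V -> \bar R} => m B)) (big_nth m0).
  by rewrite size_map -cardE big_mkord.
rewrite -nuE; apply: (measure_unique G (fun=> setT)) => //.
- by rewrite bigcup_const.
- by move=> B /muG ->; exact/esym/nuE.
Qed.

End mixture.

Lemma prod_natr_forall (R : comNzRingType) (I : finType) (b : pred I) :
  \prod_i (b i)%:R = [forall i, b i]%:R :> R.
Proof.
case: forallP => [bT|/forallP]; first by rewrite big1// => i _; rewrite bT.
by rewrite negb_forall => /existsP[i /negbTE bi]; rewrite (bigD1 i)//= bi mul0r.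
Qed.

(** * Resampling maps and a generating class of product sets *)

Section resampling.
Context {dX} {X : measurableType dX} {m B : nat}.

Let sample := m.-tuple X.
Let space := (sample * B.-tuple sample)%type.

(** [g i] is the index of the observation picked at draw i, so the m ^ m maps g enumerate the
    outcomes of drawing m times with replacement. *)
Definition resample (g : {ffun 'I_m -> 'I_m}) (x : sample) : sample :=
  [tuple tnth x (g i) | i < m].

Definition resamples (f : {ffun 'I_B -> {ffun 'I_m -> 'I_m}}) (x : sample) :
  B.-tuple sample := [tuple resample (f b) x | b < B].

Lemma measurable_resample g : measurable_fun setT (resample g).
Proof.
apply/measurable_fun_tnthP => i.
rewrite (_ : _ \o _ = (@tnth _ X)^~ (g i)); first exact: measurable_tnth.
by apply/funext => x /=; rewrite tnth_mktuple.
Qed.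

Lemma measurable_resamples f : measurable_fun setT (resamples f).
Proof.
apply/measurable_fun_tnthP => b.
rewrite (_ : _ \o _ = resample (f b)); first exact: measurable_resample.
by apply/funext => x /=; rewrite tnth_mktuple.
Qed.

(** The events whose probability [bootstrap_samples] prescribes, seen in the space of pairs of data
    and bootstrap samples. *)
Definition box (A : set sample) (E : 'I_B -> 'I_m -> set X) : set space :=
  A `*` [set y | forall b i, E b i (tnth (tnth y b) i)].

Definition boxes : set (set space) := [set H | exists A E,
  [/\ measurable A, forall b i, measurable (E b i) & H = box A E]].

Lemma measurable_box A E : measurable A -> (forall b i, measurable (E b i)) ->
  measurable (box A E).
Proof.
move=> mA mE; apply: measurableX => //.
rewrite (_ : mkset _ = \bigcap_b \bigcap_i
    ((fun y : B.-tuple sample => tnth (tnth y b) i) @^-1` E b i)); last first.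
  by apply/seteqP; split => y /= yE b; [move=> _ i _; exact: yE|move=> i; exact: yE].
apply: fin_bigcap_measurable => // b _; apply: fin_bigcap_measurable => // i _.
rewrite -[X in measurable X]setTI.
have /measurable_fun_tnthP/(_ i) :
    measurable_fun setT (fun y : B.-tuple sample => tnth y b).
  exact: measurable_tnth.
by apply.
Qed.

Lemma setI_closed_boxes : setI_closed boxes.
Proof.
move=> _ _ [A [E [mA mE ->]]] [A' [E' [mA' mE' ->]]].
exists (A `&` A'), (fun b i => E b i `&` E' b i); split => //.
- exact: measurableI.
- by move=> b i; exact: measurableI.
- apply/seteqP; split => -[x y] /=.
    by move=> [[Ax Ey] [A'x E'y]]; split.
  by move=> [[Ax A'x] EE'y]; split; split => // b i; have [] := EE'y b i.
Qed.

Lemma boxes_setT : boxes setT.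
Proof.
exists setT, (fun _ _ => setT); split => //.
by apply/seteqP; split.
Qed.

Lemma measurable_boxesE : @measurable _ space = <<s boxes >>.
Proof.
apply/seteqP; split; last first.
  apply: smallest_sub; first exact: sigma_algebra_measurable.
  by move=> _ [A [E [mA mE ->]]]; exact: measurable_box.
(* The inclusion is measurability of the identity out of the sigma-algebra generated by the boxes.
   It is checked on coordinates, whose preimages are boxes. *)
pose Bx : measurableType _ := g_sigma_algebraType boxes.
suff mid : measurable_fun [set: Bx] (id : Bx -> space).
  by move=> H mH; have := mid measurableT H mH; rewrite setTI.
apply/measurable_fun_pairP; split.
  move=> _ A mA; rewrite setTI; apply: sub_sigma_algebra.
  exists A, (fun _ _ => setT); split => //.
  by apply/seteqP; split => [[x y]//|[x y] []].
apply/measurable_fun_tnthP => b; apply/measurable_fun_tnthP => i.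
move=> _ A mA; rewrite setTI; apply: sub_sigma_algebra.
exists setT, (fun b' i' => if (b' == b) && (i' == i) then A else setT); split => //.
  by move=> b' i'; case: ifP.
apply/seteqP; split => [[x y] /= Ay|[x y] [_ /= /(_ b i)]]; last by rewrite !eqxx.
by split => // b' i'; case: ifPn => // /andP[/eqP-> /eqP->].
Qed.

End resampling.

(** * The joint law of the data and the bootstrap samples *)

Section joint_law.
Local Open Scope ereal_scope.
Context {R : realType} {dO} {Omega : measurableType dO} (Prob : probability Omega R).
Context {dX} {X : measurableType dX} {m B : nat} (hm : (0 < m)%N).

Definition resample_weight : R := ((m ^ m) ^ B)%:R^-1.

(** Each factor is an average of indicators over the m indices. Distributing first the product over
    i and then that over b over these sums yields one term for each choice f of all indices. *)
Lemma prod_empirical (x : m.-tuple X) (E : 'I_B -> 'I_m -> set X) :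
  \prod_(b < B) \prod_(i < m) empirical hm x (E b i) =
  (resample_weight * \sum_(f : {ffun 'I_B -> {ffun 'I_m -> 'I_m}})
     \1_[set x' | forall b i, E b i (tnth x' (f b i))] x)%:E.
Proof.
have empE b i : empirical hm x (E b i) =
    (m%:R^-1 * \sum_(j < m) (tnth x j \in E b i)%:R)%:E.
  rewrite /empirical EFinM -sumEFin; congr (_ * _).
under eq_bigr do under eq_bigr do rewrite empE.
under eq_bigr do rewrite prodEFin big_split/= prodr_const card_ord bigA_distr_bigA.
rewrite prodEFin big_split/= prodr_const card_ord bigA_distr_bigA/=.
congr (_ * _)%:E; first by rewrite /resample_weight !natrX -!exprVn.
apply: eq_bigr => f _; under eq_bigr do rewrite prod_natr_forall.
rewrite prod_natr_forall indicE; congr (_%:R); congr (nat_of_bool _).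
apply/idP/idP => [/forallP xE|/set_mem xE].
  by apply/mem_set => b i; have /forallP/(_ i)/set_mem := xE b.
by apply/forallP => b; apply/forallP => i; apply/mem_set/xE.
Qed.

(** The law of the pair is the uniform mixture over f of the laws of (D, [resamples f D]): the two
    agree on boxes by [hboot] and [prod_empirical], hence everywhere by [eq_mixture]. *)
Lemma joint_law (D : Omega -> m.-tuple X) (Xstar : 'I_B -> 'I_m -> {RV Prob >-> X})
    (H : set (m.-tuple X * B.-tuple (m.-tuple X))) :
  measurable_fun setT D -> bootstrap_samples Prob hm D Xstar -> measurable H ->
  Prob [set w | H (D w, [tuple [tuple Xstar b i w | i < m] | b < B])] =
  \int[Prob]_w (resample_weight *
    \sum_(f : {ffun 'I_B -> {ffun 'I_m -> 'I_m}}) \1_H (D w, resamples f (D w)))%:E.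
Proof.
move=> mD hboot mH.
pose Z w := (D w, [tuple [tuple Xstar b i w | i < m] | b < B]).
have mZ : measurable_fun setT Z.
  apply: measurable_fun_pair => //; apply/measurable_fun_tnthP => b.
  apply/measurable_fun_tnthP => i.
  rewrite (_ : _ \o _ = Xstar b i)//.
  by apply/funext => w /=; rewrite !tnth_mktuple.
pose Zf (f : {ffun 'I_B -> {ffun 'I_m -> 'I_m}}) w := (D w, resamples f (D w)).
have mZf f : measurable_fun setT (Zf f).
  apply: measurable_fun_pair => //.
  by apply: measurableT_comp => //; exact: measurable_resamples.
have w_ge0 : (0 <= resample_weight)%R by rewrite invr_ge0.
have mHf f : measurable (Zf f @^-1` H) by rewrite -[X in measurable X]setTI; exact: mZf.
have integral_sum_indic (A : set Omega)
    (F : {ffun 'I_B -> {ffun 'I_m -> 'I_m}} -> set Omega) :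
    measurable A -> (forall f, measurable (F f)) ->
    \int[Prob]_(w in A) (resample_weight * \sum_f \1_(F f) w)%:E =
    resample_weight%:E * \sum_f Prob (F f `&` A).
  move=> mA mF; under eq_integral do rewrite EFinM -sumEFin.
  rewrite ge0_integralZl_EFin//; last 2 first.
  - by move=> w _; apply: sume_ge0 => f _; rewrite lee_fin.
  - by apply: emeasurable_sum => f; exact/measurable_EFinP.
  rewrite ge0_integral_sum//; last by move=> f; exact/measurable_EFinP.
  by congr (_ * _); apply: eq_bigr => f _; rewrite integral_indic.
rewrite (integral_sum_indic setT (fun f => Zf f @^-1` H))//.
under eq_bigr do rewrite setIT.
apply: (@eq_mixture _ _ _ _ (NngNum w_ge0) boxes (distribution Prob (RV_of Prob mZ))
  (fun f => distribution Prob (RV_of Prob (mZf f)))) => //.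
- exact: measurable_boxesE.
- exact: setI_closed_boxes.
- exact: boxes_setT.
- apply: le_lt_trans (ltry 1).
  exact: (probability_le1 (distribution Prob (RV_of Prob mZ)) measurableT).
move=> _ [A [E [mA mE ->]]] /=.
have mDA : measurable (D @^-1` A) by rewrite -[X in measurable X]setTI; exact: mD.
transitivity (Prob (D @^-1` A `&` \bigcap_b \bigcap_i (Xstar b i @^-1` E b i))).
  rewrite /distribution /pushforward/=; congr (Prob _); apply/seteqP.
  split => w /= [Aw Ew]; split => //.
    by move=> b _ i _; have := Ew b i; rewrite !tnth_mktuple.
  by move=> b i; rewrite !tnth_mktuple; exact: Ew.
rewrite hboot//; under eq_integral do rewrite prod_empirical.
pose F (f : {ffun 'I_B -> {ffun 'I_m -> 'I_m}}) :=
  D @^-1` [set x | forall b i, E b i (tnth x (f b i))].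
have mF f : measurable (F f).
  rewrite (_ : F f = Zf f @^-1` box setT E); last first.
    apply/seteqP; split => w /=.
      by move=> xE; split => // b i /=; rewrite !tnth_mktuple; exact: xE.
    by move=> [_ xE] b i; have := xE b i; rewrite /= !tnth_mktuple.
  by rewrite -[X in measurable X]setTI; apply: mZf => //; exact: measurable_box.
rewrite (integral_sum_indic _ F)//; congr (_ * _); apply: eq_bigr => f _.
rewrite /distribution /pushforward/=; congr (Prob _); apply/seteqP.
split => w /= [].
  by move=> Fw Aw; split => //= b i; rewrite !tnth_mktuple; exact: Fw.
by move=> Aw Ew; split => //= b i; have := Ew b i; rewrite !tnth_mktuple.
Qed.

End joint_law.

Lemma sum_natr_card (R : pzSemiRingType) (T : finType) (P : pred T) :
  \sum_t (P t)%:R = #|P|%:R :> R.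
Proof. by rewrite -natr_sum -sum1_card [in RHS]big_mkcond. Qed.

(** * Independent uniform draws from a finite set and the binomial law *)

Section bernoulli_trials.
Context {R : realType} {T : finType} (good : pred T) {B : nat}.
Hypothesis T_gt0 : (0 < #|T|)%N.

Definition frequency : R := #|good|%:R / #|T|%:R.

Let card_neq0 : #|T|%:R != 0 :> R. Proof. by rewrite pnatr_eq0 -lt0n. Qed.

Lemma frequency_01 : 0 <= frequency <= 1.
Proof.
rewrite divr_ge0//= ler_pdivrMr ?mul1r ?ltr0n// ler_nat.
exact: max_card.
Qed.

(** Under the uniform law on functions f the values f b are independent, so the mean of a product is
    the product of the means. *)
Lemma mean_trials (u : 'I_B -> T -> R) :
  (#|T| ^ B)%:R^-1 * \sum_(f : {ffun 'I_B -> T}) \prod_b u b (f b) =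
  \prod_b (#|T|%:R^-1 * \sum_t u b t).
Proof.
by rewrite big_split/= prodr_const card_ord bigA_distr_bigA/= natrX exprVn.
Qed.

Lemma mean_trial (b : 'I_B) :
  (#|T| ^ B)%:R^-1 * \sum_(f : {ffun 'I_B -> T}) (good (f b))%:R = frequency.
Proof.
under eq_bigr => f _.
  (* The event becomes a product over all trials, with trivial factors away from b. *)
  have -> : good (f b) = [forall b', (b' == b) ==> good (f b')].
    apply/idP/forallP => [gfb b'|/(_ b)]; last by rewrite eqxx.
    by apply/implyP => /eqP ->.
  rewrite -prod_natr_forall; over.
rewrite (mean_trials (fun b' t => ((b' == b) ==> good t)%:R)) (bigD1 b)//= eqxx/=.
rewrite sum_natr_card big1 => [|b' /negbTE ->]; first by rewrite mulr1 mulrC.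
by rewrite sumr_const mulVf.
Qed.

Lemma mean_trials_set (J : {set 'I_B}) :
  (#|T| ^ B)%:R^-1 * \sum_(f : {ffun 'I_B -> T}) ([set b | good (f b)]%SET == J)%:R =
  frequency ^+ #|J| * (1 - frequency) ^+ (B - #|J|).
Proof.
under eq_bigr => f _.
  have -> : ([set b | good (f b)]%SET == J) = [forall b, good (f b) == (b \in J)].
    apply/eqP/eqfunP => [<- b|JE]; first by rewrite inE.
    by apply/setP => b; rewrite inE JE.
  rewrite -prod_natr_forall; over.
rewrite (mean_trials (fun b t => (good t == (b \in J))%:R)).
rewrite (bigID (mem J))/=; congr (_ * _).
  rewrite -prodr_const; apply: eq_bigr => b ->.
  rewrite sum_natr_card mulrC /frequency; congr (_%:R / _).
  by apply: eq_card => t; rewrite unfold_in eqb_id.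
have -> : (B - #|J| = #|(~: J)%SET|)%N.
  apply/eqP; rewrite -(eqn_add2l #|J|) cardsC card_ord subnKC//.
  by rewrite -[leqRHS]card_ord max_card.
rewrite -prodr_const; apply: eq_big => [b|b /negbTE ->]; first by rewrite inE.
rewrite (eq_bigr (fun t => 1 - (good t)%:R)) => [|t _]; last first.
  by case: (good t); rewrite /= ?subrr ?subr0.
by rewrite sumrB sumr_const sum_natr_card mulrBr mulVf// mulrC.
Qed.

(** Sum over the set J of successful trials: by [mean_trials_set] its probability depends only on
    its size i, and there are ['C(B, i)] sets of that size. *)
Lemma mean_trials_count (l u : nat) : (u <= B.+1)%N ->
  (#|T| ^ B)%:R^-1 *
    \sum_(f : {ffun 'I_B -> T}) (l <= #|[set b | good (f b)]%SET| < u)%N%:R =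
  \sum_(l <= i < u) binomial_mass B i frequency.
Proof.
move=> uB; pose inr i := (l <= i < u)%N.
transitivity (\sum_(J : {set 'I_B}) (inr #|J|)%:R *
    (frequency ^+ #|J| * (1 - frequency) ^+ (B - #|J|))).
  under [RHS]eq_bigr do rewrite -mean_trials_set mulrCA mulr_sumr.
  rewrite -mulr_sumr exchange_big; congr (_ * _); apply: eq_bigr => f _ /=.
  rewrite (bigD1 [set b | good (f b)]%SET)//= eqxx mulr1 big1 ?addr0// => J.
  by rewrite eq_sym => /negbTE ->; rewrite mulr0.
have cardJ (J : {set 'I_B}) : (#|J| < B.+1)%N.
  by rewrite ltnS; apply: leq_trans (max_card _) _; rewrite card_ord.
rewrite (partition_big (fun J : {set 'I_B} => Ordinal (cardJ J)) predT)//=.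
(* As [u <= B.+1], the right-hand sum can run over all sizes 0 to B, with the range condition kept
   as a filter. *)
rewrite [RHS](big_nat_widen _ _ B.+1)// (big_nat_widenl l 0)//= big_mkord.
rewrite [RHS]big_mkcond.
apply: eq_bigr => i _.
rewrite (eq_bigr (fun=> (inr i)%:R * (frequency ^+ i * (1 - frequency) ^+ (B - i)))); last first.
  by move=> J /eqP <-.
rewrite sumr_const.
have -> : #|[pred J : {set 'I_B} | Ordinal (cardJ J) == i]| = 'C(B, i).
  have := card_draws 'I_B i; rewrite card_ord => <-; rewrite cardsE.
  by apply: eq_card => J; rewrite !inE -val_eqE.
rewrite -[LHS]mulr_natl /binomial_mass andbC -/(inr i); case: (inr i); first by rewrite mul1r.
by rewrite mul0r mulr0.
Qed.

End bernoulli_trials.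

(** * Order statistics and counting *)

Lemma nth_sorted_le (R : realDomainType) (t : seq R) (k : nat) (s : R) :
  sorted <=%R t -> (k < size t)%N ->
  (nth 0 t k <= s) = (k < count (fun x : R => x <= s)%R t)%N.
Proof.
elim: t k => [//|x t IHt] k /=; rewrite le_path_sortedE => /andP[x_min st].
(* The entries at most s form a prefix: once the head exceeds s, so does every later entry. *)
have [xs|sx] := leP x s; first by case: k => //= k kt; rewrite add1n ltnS IHt.
have t_gt y : y \in t -> s < y by move=> /(allP x_min); exact: lt_le_trans.
move=> kt; rewrite add0n (@eq_in_count _ _ pred0) => [|y /t_gt]; last first.
  by move=> sy; rewrite /= leNgt sy.
rewrite count_pred0 ltn0; case: k kt => [_|k kt] /=; first by rewrite leNgt sx.
by rewrite leNgt t_gt// mem_nth.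
Qed.

Lemma order_stat_le (R : realType) (B : nat) (W : 'I_B -> R) (k : nat) (s : R) :
  (order_stat W k <= s%:E)%E = (k <= #|[set b | (W b <= s)%R]%SET|)%N.
Proof.
have -> : #|[set b | (W b <= s)%R]%SET| =
    count (fun x : R => x <= s)%R (sort <=%R (codom W)).
  by rewrite (permP (permEl (perm_sort _ _))) count_map cardsE cardE size_filter enumT.
rewrite /order_stat; case: k => [|k] /=; first by rewrite ?leNye.
have size_W : size (sort <=%R (codom W)) = B by rewrite size_sort size_codom card_ord.
have [kB|Bk] := ltnP k B.
  by rewrite (nth_map 0) ?size_W// lee_fin nth_sorted_le ?size_W// sort_le_sorted.
(* For k > B the order statistic is +oo, and a count of at most B never reaches k. *)
rewrite nth_default ?size_map ?size_W// leye_eq/=.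
by apply/esym/negbTE; rewrite -leqNgt (leq_trans (count_size _ _))// size_W.
Qed.

Lemma measurable_le_set d (T : measurableType d) (R : realType) (f g : T -> R) :
  measurable_fun setT f -> measurable_fun setT g ->
  measurable [set x | f x <= g x].
Proof.
move=> mf mg; have := measurable_fun_ler mf mg.
by move=> /(_ measurableT [set true]); rewrite setTI; exact.
Qed.

(** * An explicit conditional distribution function and the coverage in terms of it *)

Section bootstrap.
Context {R : realType} {dO} {Omega : measurableType dO} (Prob : probability Omega R).
Context {dX} {X : measurableType dX} {m B : nat} (hm : (0 < m)%N).
Variables (D : Omega -> m.-tuple X) (Xstar : 'I_B -> 'I_m -> {RV Prob >-> X}).
Hypotheses (mD : measurable_fun setT D) (hboot : bootstrap_samples Prob hm D Xstar).
Variables (s : m.-tuple X -> R) (ws : m.-tuple X * m.-tuple X -> R).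
Hypotheses (ms : measurable_fun setT s) (mws : measurable_fun setT ws).

Let W w b := ws (D w, [tuple Xstar b i w | i < m]).

Let good (x : m.-tuple X) : pred {ffun 'I_m -> 'I_m} :=
  fun g => ws (x, resample g x) <= s x.

(** An explicit version of F_0, with values in [0, 1] everywhere: the proportion of the m ^ m
    resamplings of x whose statistic is at most s x. *)
Definition bootstrap_cdf (x : m.-tuple X) : R := frequency (good x).

Let card_resample : #|{: {ffun 'I_m -> 'I_m}}| = (m ^ m)%N.
Proof. by rewrite card_ffun !card_ord. Qed.

Let card_resample_gt0 : (0 < #|{: {ffun 'I_m -> 'I_m}}|)%N.
Proof. by rewrite card_resample expn_gt0 hm. Qed.

Lemma bootstrap_cdf_01 x : 0 <= bootstrap_cdf x <= 1.
Proof. exact: frequency_01. Qed.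

Lemma measurable_bootstrap_cdf : measurable_fun setT bootstrap_cdf.
Proof.
rewrite /bootstrap_cdf /frequency; apply: measurable_funM => //.
under eq_fun do rewrite -sum_natr_card.
apply: measurable_sum => g.
rewrite (_ : (fun _ => _) = \1_[set x | ws (x, resample g x) <= s x]); last first.
  apply/funext => x; rewrite indicE; congr (_%:R); congr (nat_of_bool _).
  by apply/idP/idP => [/mem_set|/set_mem].
apply: measurable_indic; apply: measurable_le_set => //.
apply: measurableT_comp => //; apply: measurable_fun_pair => //.
exact: measurable_resample.
Qed.

Let below (b : 'I_B) : set (m.-tuple X * B.-tuple (m.-tuple X)) :=
  [set z | ws (z.1, tnth z.2 b) <= s z.1].

Let measurable_below b : measurable (below b).
Proof.
apply: measurable_le_set; last exact: measurableT_comp.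
apply: measurableT_comp => //; apply: measurable_fun_pair => //.
exact: (measurableT_comp (@measurable_tnth _ _ _ b) measurable_snd).
Qed.

(** Apply [joint_law] to the event that the data lie in A and W_b is at most s. For fixed data, the
    average over f involves only f b and is given by [mean_trial]. *)
Lemma bootstrap_cdf_cond_prob (b : 'I_B) :
  is_cond_prob Prob D [set w | W w b <= s (D w)] bootstrap_cdf.
Proof.
split; first exact: measurable_bootstrap_cdf.
  apply: measurable_bounded_integrable => //.
  - exact: le_lt_trans (probability_le1 Prob measurableT) (ltry 1).
  - exact: measurableT_comp measurable_bootstrap_cdf mD.
  - exists 1; split; first exact: num_real.
    move=> y y1 w _ /=; have := bootstrap_cdf_01 (D w).
    by move=> /andP[F0 F1]; rewrite ger0_norm// (le_trans F1)// ltW.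
move=> A mA.
have mH : measurable ((A `*` setT) `&` below b).
  by apply: measurableI => //; exact: measurableX.
have := joint_law mD hboot mH.
have -> : [set w | (A `*` setT `&` below b)
      (D w, [tuple [tuple Xstar b0 i w | i < m] | b0 < B])] =
    D @^-1` A `&` [set w | W w b <= s (D w)].
  by apply/seteqP; split => w /=; rewrite /below /= tnth_mktuple => -[]; [case|].
move=> ->; rewrite [RHS]integral_mkcond; apply: eq_integral => w _.
rewrite patchE; case: ifPn => [/set_mem Aw|/negP Aw]; last first.
  rewrite big1 ?mulr0// => f _; rewrite indicE memNset// => -[[/= DwA _] _].
  by apply: Aw; exact/mem_set.
congr EFin; rewrite /bootstrap_cdf -(mean_trial _ _ b)// card_resample.
congr (_ * _); apply: eq_bigr => f _; rewrite indicE; congr (_%:R).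
congr (nat_of_bool _); apply/idP/idP => [/set_mem[_]|gfb].
  by rewrite /below/= tnth_mktuple.
by apply/mem_set; split => //; rewrite /below/= tnth_mktuple.
Qed.

(** By [joint_law] the probability is the mean over the data of an average over f, which
    [mean_trials_count] evaluates as a sum of binomial masses, that is, a difference of two
    tails. *)
Lemma coverage_bootstrap_cdf (l u : nat) : (l <= u <= B.+1)%N ->
  Prob [set w | (l <= #|[set b | (W w b <= s (D w))%R]%SET| < u)%N] =
  (\int[Prob]_w (binomial_tail B l (bootstrap_cdf (D w)) -
                 binomial_tail B u (bootstrap_cdf (D w)))%:E)%E.
Proof.
move=> lu; have /andP[_ uB] := lu.
pose H := [set z : m.-tuple X * B.-tuple (m.-tuple X) |
  (l <= #|[set b | (ws (z.1, tnth z.2 b) <= s z.1)%R]%SET| < u)%N].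
have mH : measurable H.
  pose count z : R := \sum_b \1_(below b) z.
  have mcount : measurable_fun setT count.
    by apply: measurable_sum => b; exact: measurable_indic.
  have -> : H = count @^-1` `[l%:R, u%:R[.
    have countE z : count z = #|[set b | (ws (z.1, tnth z.2 b) <= s z.1)%R]%SET|%:R.
      rewrite cardsE -sum_natr_card; apply: eq_bigr => b _; rewrite indicE.
      congr (_%:R); congr (nat_of_bool _).
      by apply/idP/idP => [/set_mem|?]; [|exact/mem_set].
    by apply/seteqP; split => z; rewrite /H /= in_itv/= countE ler_nat ltr_nat.
  by rewrite -[X in measurable X]setTI; exact: mcount.
have := joint_law mD hboot mH.
have HE (x : m.-tuple X) (y : 'I_B -> m.-tuple X) : H (x, [tuple y b | b < B]) =
    (l <= #|[set b | (ws (x, y b) <= s x)%R]%SET| < u)%N.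
  by rewrite /H/=; under eq_finset do rewrite tnth_mktuple.
under [X in Prob X]eq_set do rewrite HE.
move=> ->; apply: eq_integral => w _; congr EFin.
rewrite binomial_tailB// -mean_trials_count// card_resample.
congr (_ * _); apply: eq_bigr => f _; rewrite indicE; congr (_%:R).
congr (nat_of_bool _).
by apply/idP/idP => [/set_mem|gf]; [|apply/mem_set]; rewrite /resamples HE.
Qed.

End bootstrap.

(** * Uniqueness of conditional probabilities given the data *)

Section cond_prob_uniqueness.
Context {R : realType} {dO} {Omega : measurableType dO} (Prob : probability Omega R).
Context {dV} {V : measurableType dV} (D : Omega -> V) (mD : measurable_fun setT D).

(** Transported to the law of D, both versions have the same integral over every measurable set. *)
Lemma is_cond_prob_ae_eq (E : set Omega) (F F' : V -> R) :
  is_cond_prob Prob D E F -> is_cond_prob Prob D E F' ->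
  ae_eq (distribution Prob (RV_of Prob mD)) setT (EFin \o F) (EFin \o F').
Proof.
move=> [mF iF FE] [mF' iF' F'E].
have iDF f : measurable_fun setT f -> Prob.-integrable setT (fun w => (f (D w))%:E) ->
    (distribution Prob (RV_of Prob mD)).-integrable setT (EFin \o f).
  move=> mf i_f; apply: integrable_pushforward => //.
  exact/measurable_EFinP.
apply: integral_ae_eq => //; [exact: iDF|exact/measurable_EFinP|].
move=> A _ mA.
have intE f : measurable_fun setT f -> Prob.-integrable setT (fun w => (f (D w))%:E) ->
    (\int[distribution Prob (RV_of Prob mD)]_(x in A) (EFin \o f) x =
     \int[Prob]_(w in D @^-1` A) (f (D w))%:E)%E.
  move=> mf i_f; apply: integral_pushforward => //; first exact/measurable_EFinP.
  apply: integrableS i_f => //.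
  by rewrite -[X in measurable X]setTI; exact: mD.
by rewrite !intE// -FE// -F'E.
Qed.

(** This lets an arbitrary version of F_0 be exchanged for [bootstrap_cdf], since only the law of
    F_0(D) matters. *)
Lemma is_cond_prob_distribution (E : set Omega) (F F' : V -> R) (A : set R) :
  is_cond_prob Prob D E F -> is_cond_prob Prob D E F' -> measurable A ->
  Prob [set w | A (F (D w))] = Prob [set w | A (F' (D w))].
Proof.
move=> cF cF' mA; have [mF _ _] := cF; have [mF' _ _] := cF'.
pose mu := distribution Prob (RV_of Prob mD).
have mpre (f : V -> R) : measurable_fun setT f -> measurable (f @^-1` A).
  by move=> mf; rewrite -[X in measurable X]setTI; exact: mf.
have muE f : measurable_fun setT f ->
    Prob [set w | A (f (D w))] = (\int[mu]_x (\1_(f @^-1` A) x)%:E)%E.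
  by move=> mf; rewrite integral_indic ?setIT//; exact: mpre.
rewrite !muE//; apply: ae_eq_integral => //.
- by apply/measurable_EFinP; apply: measurable_indic; exact: mpre.
- by apply/measurable_EFinP; apply: measurable_indic; exact: mpre.
apply: filterS (is_cond_prob_ae_eq cF cF') => x /(_ I) [FF'] _.
by rewrite -[LHS]/((\1_A (F x))%:E) FF'.
Qed.

End cond_prob_uniqueness.

(** * Measurability of maps into row vectors, by coordinates *)

Lemma measurable_fun_rV d (T : measurableType d) d' (T' : measurableType d')
    (n : nat) (f : T -> 'rV[T']_n) :
  (forall j, measurable_fun setT (fun x => f x ord0 j)) -> measurable_fun setT f.
Proof.
move=> mf; apply: (measurability (\big[setU/set0]_(j < n)
  preimage_set_system setT (fun v : 'rV[T']_n => v ord0 j) measurable)) => //.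
move=> _ [A + <-]; rewrite -bigcup_seq => -[j _ [C mC <-]].
by rewrite setTI; exact: mf.
Qed.

Lemma measurable_rV_coord d (T : measurableType d) (n : nat) (j : 'I_n) :
  measurable_fun setT (fun v : 'rV[T]_n => v ord0 j).
Proof.
move=> _ Y mY; rewrite setTI; apply: sub_sigma_algebra => /=.
rewrite -bigcup_seq/=; exists j => /=; first by rewrite mem_index_enum.
by exists Y => //; rewrite setTI.
Qed.

Lemma measurable_scale_sub_rV (R : realType) d (T : measurableType d) (n : nat)
    (c : R) (f g : T -> 'rV[R]_n) :
  measurable_fun setT f -> measurable_fun setT g ->
  measurable_fun setT (fun x => c *: (f x - g x)).
Proof.
move=> mf mg; apply: measurable_fun_rV => j.
rewrite (_ : (fun _ => _) = (fun x => c * (f x ord0 j - g x ord0 j))); last first.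
  by apply/funext => x; rewrite !mxE.
apply: measurable_funM => //; apply: measurable_funB.
  exact: measurableT_comp (measurable_rV_coord j) mf.
exact: measurableT_comp (measurable_rV_coord j) mg.
Qed.

(** * The uniform case and the confidence set *)

Lemma Rintegral_uniform_binomial_tail (R : realType) (mu : probability R R)
    (n l u : nat) :
  (forall A : set R, measurable A -> mu A = uniform_prob (@ltr01 R) A) ->
  (l <= u <= n.+1)%N ->
  \int[mu]_(p in `[0, 1]) (binomial_tail n l p - binomial_tail n u p) =
  (u - l)%:R / n.+1%:R.
Proof.
move=> muE lu; have /andP[_ un] := lu.
have h_ge0 (p : R) : 0 <= p <= 1 -> 0 <= binomial_tail n l p - binomial_tail n u p.
  by move=> p01; rewrite subr_ge0 le_binomial_tail//; case/andP : lu.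
have mh : measurable_fun setT (fun p : R => binomial_tail n l p - binomial_tail n u p).
  by apply: measurable_funB; exact: measurable_binomial_tail.
pose unif : probability (measurableTypeR R) R := uniform_prob (@ltr01 R).
(* R and measurableTypeR R, on which the Lebesgue measure lives, have the same
   measurable sets but different displays, whence the transfer along id. *)
have mid : measurable_fun setT (id : measurableTypeR R -> R) by [].
transitivity (fine (\int[distribution unif (RV_of unif mid)]_(p in `[0%R, 1%R])
    (binomial_tail n l p - binomial_tail n u p)%:E)%E).
  by congr fine; apply: eq_measure_integral => A mA _; exact: muE.
rewrite ge0_integral_pushforward//; last 2 first.
- by apply/measurable_EFinP; exact: measurable_funTS.
- by move=> p; rewrite inE/= in_itv/= => /h_ge0; rewrite lee_fin.
rewrite /= preimage_id.
rewrite integral_mkcond integral_uniform; last 2 first.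
- apply/(measurable_restrictT _ _).1 => //.
  by apply: measurable_funTS; exact/measurable_EFinP.
- by apply: erestrict_ge0 => p /=; rewrite in_itv/= => /h_ge0; rewrite lee_fin.
rewrite subr0 invr1 mul1e -integral_mkcondr setIid.
(* The difference of tails is a sum of [u - l] masses, each of integral 1 / (n + 1). *)
under eq_integral do rewrite binomial_tailB// -sumEFin big_nat_cond.
rewrite integral_sum//; last first.
  by move=> i; exact: integrable_binomial_mass.
rewrite (eq_bigr (fun=> (n.+1%:R^-1)%:E)) => [|i]; last first.
  by rewrite andbT => /andP[_ iu]; rewrite integral_binomial_mass// -ltnS (leq_trans iu).
by rewrite -big_nat_cond sumEFin sumr_const_nat /= mulr_natl.
Qed.

Theorem corollary1 (R : realType)
  (* probability space carrying the data and the resampling *)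
  (dO : measure_display) (Omega : measurableType dO)
  (Prob : probability Omega R)
  (* data *)
  (dX : measure_display) (X : measurableType dX) (P : probability X R)
  (m : nat) (hm : (0 < m)%N) (Xs : 'I_m -> {RV Prob >-> X})
  (hiid : iid Prob P Xs)
  (* functional, S, rate *)
  (d : nat) (phi : probability X R -> 'rV[R]_d)
  (hphi : measurable_fun [set: m.-tuple X]
            (fun x : m.-tuple X => phi (empirical hm x)))
  (S : 'rV[R]_d -> R) (hS : measurable_fun [set: 'rV[R]_d] S) (tau : R)
  (* bootstrap samples *)
  (B : nat) (Xstar : 'I_B -> 'I_m -> {RV Prob >-> X})
  (hboot : bootstrap_samples Prob hm (fun w => [tuple Xs i w | i < m]) Xstar)
  (alpha : R) (halpha0 : 0 < alpha) (halpha1 : alpha < 1)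
  (* a standard uniform random variable *)
  (dU : measure_display) (OmegaU : measurableType dU)
  (Q : probability OmegaU R) (U : {RV Q >-> R})
  (hU : forall A : set R, measurable A ->
          distribution Q U A = uniform_prob (@ltr01 R) A) :
  let theta0 := phi P in
  let D (w : Omega) : m.-tuple X := [tuple Xs i w | i < m] in
  let Dstar (b : 'I_B) (w : Omega) : m.-tuple X := [tuple Xstar b i w | i < m] in
  let theta_hat (x : m.-tuple X) : 'rV[R]_d := phi (empirical hm x) in
  let Sm (w : Omega) (theta : 'rV[R]_d) : R :=
    S (tau *: (theta_hat (D w) - theta)) in
  let W (w : Omega) (b : 'I_B) : R :=
    S (tau *: (theta_hat (Dstar b w) - theta_hat (D w))) in
  (* l and k are the floor and the ceiling of nonnegative reals *)
  let l : nat := `|Num.floor (B.+1%:R * (alpha / 2))|%N in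
  let k : nat := `|Num.ceil (B.+1%:R * (1 - alpha))|%N in
  let CI (w : Omega) : set 'rV[R]_d :=
    [set theta | (order_stat (W w) l <= (Sm w theta)%:E
                  < order_stat (W w) (k + l)%N)%E] in
  let coverage : R := fine (Prob [set w | CI w theta0]) in
  let cond_prob_W_le (b : 'I_B) (F0 : m.-tuple X -> R) : Prop :=
    is_cond_prob Prob D [set w | W w b <= Sm w theta0] F0 in
  (exists F0 : m.-tuple X -> R, forall b : 'I_B, cond_prob_W_le b F0) /\
  forall (b : 'I_B) (F0 : m.-tuple X -> R), cond_prob_W_le b F0 ->
    let dKS : R := KS_dist Prob (fun w => F0 (D w)) Q U in
    `| coverage - k%:R / B.+1%:R | <= dKS /\
    - dKS <= coverage - (1 - alpha) <= B.+1%:R^-1 + dKS.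
Proof.
move=> theta0 D Dstar theta_hat Sm W l k CI coverage cond_prob_W_le.
pose s x := S (tau *: (theta_hat x - theta0)).
pose ws (z : m.-tuple X * m.-tuple X) := S (tau *: (theta_hat z.2 - theta_hat z.1)).
have ms : measurable_fun setT s.
  by apply: measurableT_comp hS _; exact: measurable_scale_sub_rV.
have mws : measurable_fun setT ws.
  apply: measurableT_comp hS _; apply: measurable_scale_sub_rV.
    exact: measurableT_comp hphi measurable_snd.
  exact: measurableT_comp hphi measurable_fst.
have mD : measurable_fun setT D.
  apply/measurable_fun_tnthP => i; rewrite (_ : _ \o _ = Xs i)//.
  by apply/funext => w /=; rewrite tnth_mktuple.
pose F := bootstrap_cdf s ws.
have cF b : cond_prob_W_le b F := bootstrap_cdf_cond_prob mD hboot ms mws b.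
split; first by exists F.
move=> b F0 cF0 dKS.
have n_gt0 : 0 < B.+1%:R :> R by rewrite ltr0n.
have lE : l%:R <= B.+1%:R * (alpha / 2).
  rewrite /l natr_absz ger0_norm ?floor_ge0 ?mulr_ge0 ?divr_ge0 ?(ltW halpha0)//.
  by case/andP: (Num.Theory.floor_itv (B.+1%:R * (alpha / 2))).
have [kl ku] : B.+1%:R * (1 - alpha) <= k%:R /\ k%:R < B.+1%:R * (1 - alpha) + 1.
  have x_ge0 : 0 <= B.+1%:R * (1 - alpha) by rewrite mulr_ge0// subr_ge0 ltW.
  rewrite /k natr_absz ger0_norm; last first.
    by rewrite ceil_ge0 (lt_le_trans _ x_ge0)// ltrN10.
  have /andP[] := Num.Theory.ceil_itv (B.+1%:R * (1 - alpha)).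
  by rewrite intrB ltrBlDr.
(* k + l < (B + 1)(1 - alpha / 2) + 1 < B + 2, so the upper index is at most B + 1, where the order
   statistic is +oo. *)
have klB : (l <= k + l <= B.+1)%N.
  rewrite leq_addl/= -ltnS -(ltr_nat R) natrD -[ltRHS]natr1.
  have : 0 < B.+1%:R * (alpha / 2) by rewrite mulr_gt0// divr_gt0.
  by lra.
have [mF0 _ _] := cF0.
pose Y := RV_of Prob (measurableT_comp mF0 mD).
pose h (p : R) := binomial_tail B l p - binomial_tail B (k + l) p.
have coverageE : coverage = \int[distribution Prob Y]_(p in `[0, 1]) h p.
  have [mF _ _] := cF b.
  pose Y' := RV_of Prob (measurableT_comp mF mD).
  rewrite /coverage /Rintegral; congr fine.
  (* Both endpoint conditions, the upper one negated, become conditions on the number of W_b that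
     are at most S_m(theta_0). *)
  have -> : [set w | CI w theta0] =
      [set w | (l <= #|[set b' | (W w b' <= s (D w))%R]%SET| < k + l)%N].
    by apply/seteqP; split => w; rewrite /CI/= order_stat_le ltNge order_stat_le -ltnNge.
  rewrite (coverage_bootstrap_cdf mD hboot ms mws klB).
  (* The law of F0(D) is replaced by that of the explicit version F(D). *)
  rewrite (eq_measure_integral (distribution Prob Y')); last first.
    by move=> A mA _; exact: is_cond_prob_distribution cF0 (cF b) mA.
  rewrite ge0_integral_pushforward//.
  - rewrite (_ : _ @^-1` _ = setT)//; apply/seteqP; split => // w _ /=.
    by rewrite in_itv/=; exact: bootstrap_cdf_01.
  - apply/measurable_EFinP; apply: measurable_funTS.
    by apply: measurable_funB; exact: measurable_binomial_tail.
  - move=> p; rewrite inE/= in_itv/= => p01.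
    by rewrite lee_fin subr_ge0 le_binomial_tail// leq_addl.
have unifE : \int[distribution Q U]_(p in `[0, 1]) h p = k%:R / B.+1%:R.
  by rewrite -[X in X%:R / _](addnK l); exact: Rintegral_uniform_binomial_tail hU klB.
(* F0 may leave [0, 1] on a null set, so the claim is read off from the explicit version, which has
   the same law. *)
have Y01 : distribution Prob Y `[0, 1]%classic = 1%E.
  rewrite [LHS](is_cond_prob_distribution mD cF0 (cF b))//.
  rewrite -(probability_setT Prob); congr (Prob _); apply/seteqP; split => // w _ /=.
  by rewrite in_itv/=; exact: bootstrap_cdf_01.
have U01 : distribution Q U `[0, 1]%classic = 1%E.
  by rewrite hU// /uniform_prob integral_uniform_pdf1.
have KS : `|coverage - k%:R / B.+1%:R| <= dKS.
  rewrite coverageE -unifE; apply: (KS_dist_monotone_diff Y01 U01).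
  - exact: continuous_binomial_tail.
  - exact: continuous_binomial_tail.
  - exact: binomial_tail_homo.
  - exact: binomial_tail_homo.
  - move=> p p01.
    by rewrite binomial_tail_ge0// le_binomial_tail ?leq_addl// binomial_tail_le1.
split=> //.
(* Rounding up moves k / (B + 1) above 1 - alpha by at most 1 / (B + 1), which accounts for the
   asymmetry of the final bounds. *)
have kl' : 1 - alpha <= k%:R / B.+1%:R by rewrite ler_pdivlMr// mulrC.
have ku' : k%:R / B.+1%:R <= 1 - alpha + B.+1%:R^-1.
  by rewrite ler_pdivrMr// mulrDl mulVf ?gt_eqF// mulrC ltW.
have shift (c K x y : R) : `|c - x| <= K -> 1 - alpha <= x ->
    x <= 1 - alpha + y -> - K <= c - (1 - alpha) <= y + K.
  by rewrite ler_norml; lra.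
exact: shift KS kl' ku'.
Qed.
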